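(* Let $X$ be a real Hilbert space and let $J:X\to\mathbf{R}$ be a functional with $J(0)=0$. For $r>0$ put $S_r=\{x\in X:\|x\|^2=r\}$ and $B_r=\{x\in X:\|x\|^2\le r\}$. For some $\rho>0$, assume that $J$ is Gâteaux differentiable in $\mathrm{int}(B_\rho)\setminus\{0\}$ and that $$\frac{\beta_\rho}{\rho}<\delta_\rho,$$ where $$\beta_\rho=\sup_{B_\rho}J,\qquad \delta_\rho=\sup_{x\in B_\rho\setminus\{0\}}\frac{J(x)}{\|x\|^2}.$$ Assume also that, for some $a>0$, with $$a>\frac{\rho}{\rho\delta_\rho-\beta_\rho}\quad\text{if }\delta_\rho<+\infty,$$ the restriction of the functional $\|\cdot\|^2-aJ(\cdot)$ to $B_\rho$ is sequentially weakly lower semicontinuous. For each $r\in\,]\beta_\rho,+\infty[$, put $$\eta(r)=\sup_{y\in B_\rho}\frac{\rho-\|y\|^2}{r-J(y)},\qquad \Gamma(r)=\left\{x\in B_\rho:\frac{\rho-\|x\|^2}{r-J(x)}=\eta(r)\right\}.$$ Then the following assertions hold: (i) the function $\eta$ is convex and decreasing in $]\beta_\rho,+\infty[$, with $\lim_{r\to+\infty}\eta(r)=0$; (ii) for each $r\in\left]\beta_\rho+\frac{\rho}{a},\rho\delta_\rho\right[$, the set $\Gamma(r)$ is non-empty and, for every $\hat x\in\Gamma(r)$, one has $0<\|\hat x\|^2<\rho$ and $$\hat x\in\left\{x\in S_{\|\hat x\|^2}:J(x)=\sup_{S_{\|\hat x\|^2}}J\right\}\subseteq\left\{x\in\mathrm{int}(B_\rho):\|x\|^2-\eta(r)J(x)=\inf_{y\in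 B_\rho}\bigl(\|y\|^2-\eta(r)J(y)\bigr)\right\}\subseteq\left\{x\in X:x=\frac{\eta(r)}{2}J'(x)\right\};$$ (iii) for each $r_1,r_2\in\left]\beta_\rho+\frac{\rho}{a},\rho\delta_\rho\right[$ with $r_1<r_2$, and each $\hat x\in\Gamma(r_1)$, $\hat y\in\Gamma(r_2)$, one has $\|\hat y\|<\|\hat x\|$; (iv) if $A$ denotes the set of all $r\in\left]\beta_\rho+\frac{\rho}{a},\rho\delta_\rho\right[$ such that $\Gamma(r)$ is a singleton, then the function $r\mapsto\Gamma(r)$ ($r\in A$), where $\Gamma(r)$ is identified with its unique element, is continuous with respect to the weak topology of $X$; if, in addition, $J$ is sequentially weakly upper semicontinuous in $B_\rho$, then $\Gamma_{|A}$ is continuous with respect to the strong (norm) topology of $X$.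
   Context: $]s,t[$ denotes the open interval with endpoints $s,t$. The quantity $\delta_\rho$ may be $+\infty$, in which case $\rho\delta_\rho=+\infty$; the assumption $\beta_\rho/\rho<\delta_\rho$ in particular requires $\beta_\rho<+\infty$. ''Decreasing'' means strictly decreasing. The Gâteaux derivative $J'(x)\in X^*$ is identified with an element of $X$ via the Riesz theorem; a set such as $\{x\in X:x=\mu J'(x)\}$ consists of points $x$ at which $J$ is Gâteaux differentiable and the equation holds. $\mathrm{int}(B_\rho)=\{x\in X:\|x\|^2<\rho\}$. *)

(* Defs.v *)
From HB Require Import structures.
From mathcomp Require Import all_boot all_order all_algebra.
From mathcomp Require Import all_classical all_reals all_analysis.

Set Implicit Arguments.
Unset Strict Implicit.
Unset Printing Implicit Defensive.

Import Order.TTheory GRing.Theory Num.Theory.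
Import numFieldNormedType.Exports.

Local Open Scope classical_set_scope.
Local Open Scope ring_scope.

(* A real Hilbert space is represented by a complete normed space together with
   an inner product that induces its norm. *)
Definition induces_norm (R : realType) (X : normedModType R)
    (dot : {dot X for @idfun R}) : Prop :=
  forall x : X, `|x| ^+ 2 = dot x x.

Definition continuous_dual (R : realType) (X : normedModType R) : Type :=
  {l : {linear X -> R} | continuous l}.

(* Same carrier as [X], with the coarsest topology making every element of
   [continuous_dual X] continuous. *)
Definition weak_space (R : realType) (X : normedModType R) : topologicalType :=
  sup_topology (fun l : continuous_dual X =>
    Topological.class (initial_topology (sval l : X -> R))).

Definition seq_lower_semicontinuous_in (R : realType) (T : topologicalType)
    (D : set T) (f : T -> R) : Prop :=
  forall (u : nat -> T) (x : T), (forall n, D (u n)) -> D x ->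
    u @ \oo --> x -> ((f x)%:E <= limn_einf (fun n => (f (u n))%:E))%E.

Definition seq_upper_semicontinuous_in (R : realType) (T : topologicalType)
    (D : set T) (f : T -> R) : Prop :=
  forall (u : nat -> T) (x : T), (forall n, D (u n)) -> D x ->
    u @ \oo --> x -> (limn_esup (fun n => (f (u n))%:E) <= (f x)%:E)%E.

Definition is_gateaux_derivative (R : realType) (X : normedModType R)
    (J : X -> R) (x : X) (l : continuous_dual X) : Prop :=
  forall v : X, is_derive x v J (sval l v).

Definition gateaux_differentiable (R : realType) (X : normedModType R)
    (J : X -> R) (x : X) : Prop :=
  exists l : continuous_dual X, is_gateaux_derivative J x l.

(* [g] is the element of [X] that the Riesz theorem associates with the
   Gateaux derivative of [J] at [x]. *)
Definition is_gateaux_gradient (R : realType) (X : normedModType R)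
    (dot : {dot X for @idfun R}) (J : X -> R) (x g : X) : Prop :=
  exists2 l : continuous_dual X, is_gateaux_derivative J x l &
    forall v : X, sval l v = dot g v.

(* Spheres and balls are parametrized by the square of their radius. *)
Definition sqsphere (R : realType) (X : normedModType R) (r : R) : set X :=
  [set x | `|x| ^+ 2 = r].

Definition sqball (R : realType) (X : normedModType R) (r : R) : set X :=
  [set x | `|x| ^+ 2 <= r].

Definition sqball_int (R : realType) (X : normedModType R) (r : R) : set X :=
  [set x | `|x| ^+ 2 < r].

Arguments sqsphere {R} X r.
Arguments sqball {R} X r.
Arguments sqball_int {R} X r.

Definition sup_on (R : realType) (T : Type) (D : set T) (f : T -> R) : \bar R :=
  ereal_sup [set (f x)%:E | x in D].

Definition inf_on (R : realType) (T : Type) (D : set T) (f : T -> R) : \bar R :=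
  ereal_inf [set (f x)%:E | x in D].

Section quantities.
Context (R : realType) (X : normedModType R) (J : X -> R) (rho : R).

Definition beta_sup : \bar R := sup_on (sqball X rho) J.

Definition delta_sup : \bar R :=
  sup_on (sqball X rho `\ 0) (fun x => J x / `|x| ^+ 2).

(* For [0 < rho], [J 0 = 0] and [beta_sup < r] this is the supremum of a nonempty
   subset of [0, rho / (r - beta_sup)], so the real-valued [sup] is the genuine
   supremum. *)
Definition eta_fun (r : R) : R :=
  sup [set (rho - `|y| ^+ 2) / (r - J y) | y in sqball X rho].

Definition Gamma_set (r : R) : set X :=
  [set x | sqball X rho x /\ (rho - `|x| ^+ 2) / (r - J x) = eta_fun r].

End quantities.

(* Main.v *)
(* For r > beta and mu = eta(r), the inequality (rho - |y|^2) / (r - J y) <= mu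
   means |y|^2 - mu J(y) >= rho - mu r, with equality exactly on Gamma(r): the
   maximizers of the quotient are the minimizers on B_rho of |.|^2 - mu J, whose
   minimum is rho - mu r. If r > beta + rho / a then mu < a, so this functional
   is a convex combination of |.|^2 and |.|^2 - a J, hence sequentially weakly
   lower semicontinuous, and weak sequential compactness of B_rho gives
   existence. If r < rho delta the value of the quotient at 0 is beaten, so
   minimizers are interior and nonzero and satisfy mu J'(x) = 2 x. For r < s,
   comparing the two minimization problems gives |y| <= |x|, and equality would
   force J'(x) = (2 / eta r) x = (2 / eta s) x. Continuity holds because, as s
   tends to r, elements of Gamma(s) form a minimizing family for the problem
   at r. *)

Require Import Defs.
From HB Require Import structures.
From mathcomp Require Import all_boot all_order all_algebra.
From mathcomp Require Import all_classical all_reals all_analysis.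
From mathcomp Require Import ring lra.

Set Implicit Arguments.
Unset Strict Implicit.
Unset Printing Implicit Defensive.

Import Order.TTheory GRing.Theory Num.Theory.
Import numFieldNormedType.Exports.

Local Open Scope classical_set_scope.
Local Open Scope ring_scope.

(** * Inner products *)

(** At [t = - b / (A + 1)] the polynomial is a negative multiple of [b ^+ 2]; the shift by 1 covers
    [A = 0]. *)
Lemma quadratic_ge0_eq0 (R : realFieldType) (A b : R) :
  (forall t, 0 <= t ^+ 2 * A + 2 * t * b) -> b = 0.
Proof.
move=> h; have A0 : 0 <= A by have := h 1; have := h (-1); lra.
have := h (- b / (A + 1)).
have -> : (- b / (A + 1)) ^+ 2 * A + 2 * (- b / (A + 1)) * b =
  - (b ^+ 2) * ((A + 2) / (A + 1) ^+ 2) by field; lra.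
have : 0 < (A + 2) / (A + 1) ^+ 2 by rewrite divr_gt0// ?exprn_gt0//; lra.
move=> k0; rewrite pmulr_lge0// oppr_ge0 => b0.
by apply/eqP; rewrite -sqrf_eq0; apply/eqP/le_anti; rewrite b0 sqr_ge0.
Qed.

Section inner_product.
Context (R : realType) (X : completeNormedModType R).
Context (dot : {dot X for @idfun R}) (hdot : induces_norm dot).

Lemma dotC x y : dot x y = dot y x.
Proof. by rewrite [LHS]hermitian_subproof expr0 mul1r. Qed.

Lemma dotBl z x y : dot (x - y) z = dot x z - dot y z.
Proof. exact: zmod_morphisml_subproof. Qed.

Lemma dotZl z a x : dot (a *: x) z = a * dot x z.
Proof. exact: linearl_subproof. Qed.

Lemma dotNl z x : dot (- x) z = - dot x z.
Proof. by rewrite -scaleN1r dotZl mulN1r. Qed.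

Lemma dotDl z x y : dot (x + y) z = dot x z + dot y z.
Proof. by rewrite -[y in LHS]opprK dotBl dotNl opprK. Qed.

Lemma dotDr z x y : dot z (x + y) = dot z x + dot z y.
Proof. by rewrite dotC dotDl !(dotC z). Qed.

Lemma dotBr z x y : dot z (x - y) = dot z x - dot z y.
Proof. by rewrite dotC dotBl !(dotC z). Qed.

Lemma dotZr z a x : dot z (a *: x) = a * dot z x.
Proof. by rewrite dotC dotZl (dotC z). Qed.

Lemma sqnormD (x y : X) : `|x + y| ^+ 2 = `|x| ^+ 2 + 2 * dot x y + `|y| ^+ 2.
Proof. by rewrite !hdot dotDl !dotDr (dotC y x); ring. Qed.

Lemma sqnormB (x y : X) : `|x - y| ^+ 2 = `|x| ^+ 2 - 2 * dot x y + `|y| ^+ 2.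
Proof. by rewrite !hdot dotBl !dotBr (dotC y x); ring. Qed.

Lemma sqnormZ a (x : X) : `|a *: x| ^+ 2 = a ^+ 2 * `|x| ^+ 2.
Proof. by rewrite !hdot dotZl dotZr; ring. Qed.

(** Cauchy-Schwarz: the squared norm of |y| x - |x| y expands to 2 |x| |y| (|x| |y| - [dot x y]). *)
Lemma dot_le_norm x y : dot x y <= `|x| * `|y|.
Proof.
have [->|x0] := eqVneq x 0.
  by rewrite -(scale0r 0) dotZl mul0r mulr_ge0.
have [->|y0] := eqVneq y 0.
  by rewrite -(scale0r 0) dotZr mul0r mulr_ge0.
have : 0 <= `| `|y| *: x - `|x| *: y| ^+ 2 by [].
have xy0 : 0 < `|x| * `|y| by rewrite mulr_gt0 ?normr_gt0.
rewrite sqnormB dotZl dotZr !sqnormZ.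
have -> : `|y| ^+ 2 * `|x| ^+ 2 - 2 * (`|y| * (`|x| * dot x y)) +
  `|x| ^+ 2 * `|y| ^+ 2 = 2 * (`|x| * `|y|) * (`|x| * `|y| - dot x y) by ring.
by rewrite pmulr_rge0 ?subr_ge0// mulr_gt0.
Qed.

Lemma norm_dot_le x y : `|dot x y| <= `|x| * `|y|.
Proof.
rewrite ler_norml dot_le_norm andbT lerNl -dotNl -[`|x|]normrN.
exact: dot_le_norm.
Qed.

Lemma dot_is_linear x : linear (dot x : X -> R).
Proof. by move=> a y z; rewrite dotDr dotZr. Qed.

HB.instance Definition _ x :=
  @GRing.isLinear.Build R X R *:%R (dot x : X -> R) (dot_is_linear x).

Lemma continuous_dot x : continuous (dot x : X -> R).
Proof.
move=> y; apply/(@cvgrPdist_le _ _ _ (nbhs y)) => e e0.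
near=> z; rewrite -dotBr (le_trans (norm_dot_le _ _))//.
have : `|y - z| < e / (`|x| + 1).
  near: z; apply: (@cvgr_dist_lt _ _ _ (nbhs y)); first exact: cvg_id.
  by rewrite divr_gt0// ltr_wpDl.
rewrite ltr_pdivlMr ?ltr_wpDl// => h; apply: le_trans (ltW h).
by rewrite mulrC ler_wpM2l// lerDl.
Unshelve. all: by end_near. Qed.

Definition dot_dual (x : X) : continuous_dual X :=
  exist _ (dot x : {linear X -> R}) (@continuous_dot x).

Lemma dual_bounded (l : continuous_dual X) :
  exists2 C, 0 < C & forall v, `|sval l v| <= C * `|v|.
Proof.
have /linear_boundedP : bounded_near (sval l) (nbhs (0 : X)).
  exact: continuous_linear_bounded (svalP l 0).
by move=> /pinfty_ex_gt0 [C C0 h]; exists C.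
Qed.

(* A minimizing sequence of |v|^2 - 2 L v is Cauchy by the parallelogram law,
   and its limit represents L. *)
Lemma Riesz (L : X -> R) (C : R) :
  (forall a x y, L (a *: x + y) = a * L x + L y) ->
  (forall v, `|L v| <= C * `|v|) -> exists g, forall v, L v = dot g v.
Proof.
move=> Llin Lbnd.
pose F v : R := `|v| ^+ 2 - 2 * L v.
have Flb v : - C ^+ 2 <= F v.
  have := Lbnd v; rewrite ler_norml => /andP[_ h].
  have := sqr_ge0 (`|v| - C); rewrite /F sqrrB; nra.
have FD v w t : F (v + t *: w) = F v + t ^+ 2 * `|w| ^+ 2 + 2 * t * (dot v w - L w).
  by rewrite /F sqnormD sqnormZ dotZr addrC [v + _]addrC Llin; ring.
have hinf : has_inf (range F).
  split; first by exists (F 0), 0.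
  by exists (- C ^+ 2) => _ [v _ <-].
pose m := inf (range F).
have Fm v : m <= F v by apply: ge_inf; [case: hinf|exists v].
have /choice[v vP] n : exists v, F v < m + n.+1%:R^-1.
  have n0 : 0 < n.+1%:R^-1 :> R by [].
  by have [_ [v _ <-] h] := inf_adherent n0 hinf; exists v.
(* [FD] is applied from [v j] towards [v i] at [t = 1] and at the midpoint, where [F] is still at
   least [m]. *)
have vd i j : `|v i - v j| ^+ 2 <= 2 * (i.+1%:R^-1 + j.+1%:R^-1).
  have := FD (v j) (v i - v j) 1; have := FD (v j) (v i - v j) (2^-1).
  rewrite scale1r subrKC => h1 h2; have := vP i; have := vP j.
  have := Fm (v j + 2^-1 *: (v i - v j)); rewrite h1 h2 {h1 h2}.
  have aux (Fj z d ei ej m0 : R) : m0 <= Fj + 2^-1 ^+ 2 * z + 2 / 2 * d ->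
    Fj < m0 + ej -> Fj + 1 ^+ 2 * z + 2 * 1 * d < m0 + ei ->
    z <= 2 * (ei + ej) by lra.
  exact: aux.
have /cauchy_cvg vcvg : cauchy (v @ \oo).
  apply: cauchy_exP => e e0.
  have [N _ HN] : \forall n \near \oo, (n.+1%:R^-1 : R) < e ^+ 2 / 4.
    apply: (cvgr_lt 0); first exact: cvg_harmonic.
    by rewrite divr_gt0// exprn_gt0.
  exists (v N); exists N => // n /= Nn.
  rewrite -ball_normE /=; have := vd N n; have := HN N (leqnn N); have := HN n Nn.
  rewrite /= -(@ltr_pXn2r _ 2)// ?nnegrE ?(ltW e0)//.
  by move: (n.+1%:R^-1) (N.+1%:R^-1) => ? ?; lra.
set g := lim _ in vcvg; exists g => w.
apply/esym/eqP; rewrite -subr_eq0; apply/eqP.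
apply: (@quadratic_ge0_eq0 _ (`|w| ^+ 2)) => t.
(* Passing to the limit in [F (v n + t *: w) >= m > F (v n) - n.+1%:R^-1] makes the quadratic in [t]
   nonnegative. *)
have h1 : (fun n => t ^+ 2 * `|w| ^+ 2 + 2 * t * (dot (v n) w - L w) + n.+1%:R^-1)
   @ \oo --> t ^+ 2 * `|w| ^+ 2 + 2 * t * (dot g w - L w) + 0.
  apply: cvgD; last exact: cvg_harmonic.
  apply: cvgD; first exact: cvg_cst.
  apply: cvgM; first exact: cvg_cst.
  apply: cvgB; last exact: cvg_cst.
  rewrite dotC; under eq_fun do rewrite dotC.
  exact: (continuous_cvg _ (@continuous_dot w g) vcvg).
rewrite addr0 in h1; apply: (ler_cvg_to (cvg_cst 0) h1).
near=> n; have := FD (v n) w t; have := Fm (v n + t *: w); have := vP n.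
rewrite /=; move: (n.+1%:R^-1) => ?. lra.
Unshelve. all: by end_near. Qed.

End inner_product.

(** * Weak sequential compactness *)

(** A supremum topology is tested on each initial topology separately. The filter is arbitrary, to
    cover sequences as well as neighbourhoods within a set. *)
Lemma weak_cvgP (R : realType) (X : normedModType R) (T : Type)
    (F : set_system T) (u : T -> X) (x : X) : Filter F ->
  (u @ F --> (x : weak_space X)) <->
  (forall l : continuous_dual X, sval l (u t) @[t --> F] --> sval l x).
Proof.
move=> FF; split => [ux l|ux].
  have /cvg_sup/(_ l) := ux.
  move=> h; apply: (cvg_comp _ _ h).
  exact: (@initial_continuous X R (sval l : X -> R) x).
apply/cvg_sup => l A /= [_ [[B Bop <-] Bfs sBfA]].
by apply: filterS sBfA _; apply: ux; exact: open_nbhs_nbhs.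
Qed.

(** Greedy extraction. The second conclusion serves a [P] that ignores its first argument, the third
    a [P] linking consecutive indices. *)
Lemma strict_subseq (P : nat -> nat -> Prop) :
  (forall m, exists2 n, (m < n)%N & P m n) ->
  exists e : nat -> nat, [/\ (forall k, (e k < e k.+1)%N),
    (forall k, exists m, (m < e k)%N /\ P m (e k)) & forall k, P (e k) (e k.+1)].
Proof.
move=> h; have /choice[f fP] m : exists n, (m < n)%N /\ P m n.
  by have [n ? ?] := h m; exists n.
(* With [k.+1] iterations even the first index is a value of [f]. *)
exists (fun k => iter k.+1 f 0%N); split => k; try by have [] := fP (iter k.+1 f 0%N).
by exists (iter k f 0%N); have [] := fP (iter k f 0%N).
Qed.

Lemma strict_ge_id (e : nat -> nat) : (forall k, (e k < e k.+1)%N) ->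
  forall k, (k <= e k)%N.
Proof. by move=> ei; elim=> // k /leq_ltn_trans; exact. Qed.

Lemma strict_homo (e : nat -> nat) : (forall k, (e k < e k.+1)%N) ->
  {homo e : i j / (i < j)%N}.
Proof. by move=> ei; apply: homo_ltn => //; exact: ltn_trans. Qed.

Lemma cvg_strict (e : nat -> nat) : (forall k, (e k < e k.+1)%N) ->
  e @ \oo --> \oo.
Proof.
move=> ei A [N _ NA]; exists N => // n /= Nn; apply: NA => /=.
exact: leq_trans Nn (strict_ge_id ei n).
Qed.

(** Compactness of [-C, C] gives a cluster point, and an ultrafilter converges to each of its
    cluster points. *)
Lemma ultra_bounded_cvg (R : realType) (T : Type) (U : set_system T)
    (f : T -> R) (C : R) : UltraFilter U -> (forall t, `|f t| <= C) ->
  cvg (f @ U).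
Proof.
move=> UU fC; have fU : (f @ U) [set` `[- C, C]].
  apply: (@filterS _ U _ setT _ _ filterT) => t _.
  by rewrite /= in_itv/= -ler_norml.
have [p [_ pcl]] := @segment_compact R (- C) C (f @ U) _ fU.
apply/cvg_ex; exists p => A pA.
have [//|nA] := in_ultra_setVsetC (f @^-1` A) UU.
by have [x []] := pcl (~` A) A nA pA.
Qed.

Section weak_compactness.
Context (R : realType) (X : completeNormedModType R).
Context (dot : {dot X for @idfun R}) (hdot : induces_norm dot).

(* Banach-Saks: almost orthogonality bounds the norm of a sum of N terms by a
   multiple of the square root of N. *)
Lemma almost_orthogonal_dual (z : nat -> X) (M : R) (l : continuous_dual X)
    (e : R) :
  0 < e -> (forall n, `|z n| ^+ 2 <= M) ->
  (forall i j, (i < j)%N -> j%:R * `|dot (z i) (z j)| <= 1) ->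
  ~ (forall n, e <= sval l (z n)).
Proof.
move=> e0 zM zo el.
pose s N := \sum_(i < N) z i.
have sN N : `|s N| ^+ 2 <= N%:R * (M + 2).
  elim: N => [|N IH]; first by rewrite /s big_ord0 normr0 expr0n/= mul0r.
  rewrite /s big_ord_recr/= -/(s N) (sqnormD hdot).
  have : dot (s N) (z N) <= 1.
    have [->|N0] := posnP N.
      by rewrite /s big_ord0 -(scale0r 0) dotZl mul0r.
    have -> : dot (s N) (z N) = \sum_(i < N) dot (z i) (z N).
      rewrite /s; elim/big_ind2: _ => [|x a y b <- <-|//].
        by rewrite -(scale0r 0) dotZl mul0r.
      by rewrite dotDl.
    (* Each of the [N] inner products is at most 1 / N. *)
    rewrite -(@ler_pM2l _ N%:R) ?ltr0n// mulr_sumr mulr1.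
    apply: (@le_trans _ _ (\sum_(i < N) 1)); last by rewrite sumr_const card_ord.
    apply: ler_sum => i _; apply: le_trans (zo _ _ (ltn_ord i)).
    by rewrite ler_wpM2l// ler_norm.
  have := zM N; rewrite -natr1; nra.
have lN N : N%:R * e <= sval l (s N).
  rewrite linear_sum/= mulr_natl.
  have <- : \sum_(i < N) e = e *+ N by rewrite sumr_const card_ord.
  by apply: ler_sum => i _; exact: el.
have [C C0 lC] := dual_bounded l.
have M0 : 0 <= M by apply: le_trans (zM 0%N).
have key N : N%:R * e ^+ 2 <= C ^+ 2 * (M + 2).
  have [->|N0] := posnP N; first by rewrite mul0r mulr_ge0 ?sqr_ge0//; lra.
  have Np : (0 : R) < N%:R by rewrite ltr0n.
  have h : (N%:R * e) ^+ 2 <= C ^+ 2 * (N%:R * (M + 2)).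
    apply: (@le_trans _ _ ((C * `|s N|) ^+ 2)).
      rewrite ler_pXn2r ?nnegrE ?mulr_ge0 ?(ltW C0) ?(ltW e0)//.
      exact: le_trans (lN N) (le_trans (ler_norm _) (lC _)).
    by rewrite exprMn ler_wpM2l ?sqr_ge0.
  by rewrite -(ler_pM2l Np); move: h; nra.
have [N] : exists N, C ^+ 2 * (M + 2) / e ^+ 2 < N%:R.
  by exists (Num.truncn (C ^+ 2 * (M + 2) / e ^+ 2)).+1; rewrite truncnS_gt.
by rewrite ltr_pdivrMr ?exprn_gt0// ltNge key.
Qed.

(** Otherwise [l] or its opposite stays above some [e] along a subsequence. Almost orthogonality
    passes to subsequences, because the weight [j] only grows under reindexing. *)
Lemma almost_orthogonal_weak_cvg0 (z : nat -> X) (M : R) (l : continuous_dual X) :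
  (forall n, `|z n| ^+ 2 <= M) ->
  (forall i j, (i < j)%N -> j%:R * `|dot (z i) (z j)| <= 1) ->
  sval l (z n) @[n --> \oo] --> (0 : R).
Proof.
move=> zM zo.
have half (w : nat -> X) (e : R) : 0 < e -> (forall n, `|w n| ^+ 2 <= M) ->
    (forall i j, (i < j)%N -> j%:R * `|dot (w i) (w j)| <= 1) ->
    \forall n \near \oo, sval l (w n) < e.
  move=> e0 wM wo; apply: contrapT => nw.
  have [|d [di dP _]] := @strict_subseq (fun m n => e <= sval l (w n)).
    move=> m; apply: contrapT => h; apply: nw; exists m.+1 => // n /= mn.
    by rewrite ltNge; apply/negP => le; apply: h; exists n.
  apply: (@almost_orthogonal_dual (w \o d) M l e) => //= [i j ij|n].
  - apply: le_trans (wo _ _ (strict_homo di ij)).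
    by rewrite ler_wpM2r// ler_nat strict_ge_id.
  - by have [m []] := dP n.
apply/cvgrPdist_lt => e e0.
have h1 := half z e e0 zM zo.
have h2 : \forall n \near \oo, sval l (- z n) < e.
  apply: (half (fun n => - z n)) => // [n|i j ij]; first by rewrite normrN.
  by rewrite dotNl dotC dotNl opprK dotC; exact: zo.
near=> n; rewrite sub0r normrN ltr_norml ltrNl -linearN.
by apply/andP; split; near: n.
Unshelve. all: by end_near. Qed.

(** The limits of [dot v (u t)] along [U] exist by boundedness and form a bounded linear functional
    of [v], which Riesz represents. *)
Lemma ultra_weak_limit (T : topologicalType) (U : set_system T) (u : T -> X) (M : R) :
  UltraFilter U -> (forall t, `|u t| <= M) ->
  exists x, forall v, dot v (u t) @[t --> U] --> dot v x.
Proof.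
move=> UU uM.
have bnd v t : `|dot v (u t)| <= M * `|v|.
  by apply: le_trans (norm_dot_le hdot _ _) _; rewrite mulrC ler_wpM2r.
have cv v : cvg (dot v (u t) @[t --> U]) by apply: ultra_bounded_cvg (bnd v).
have [a v w|v|x xP] := Riesz hdot (L := fun v => lim (dot v (u t) @[t --> U]))
  (C := M).
- apply: cvg_lim => //; under eq_fun do rewrite dotDl dotZl.
  by apply: cvgD; [apply: cvgMr|]; exact: cv.
- apply: (@ler_cvg_to _ U _ _ _ _ _ _ (cvg_norm (cv v)) (cvg_cst (M * `|v|))).
  exact: nearW.
by exists x => v; rewrite (dotC dot v x) -xP; exact: cv.
Qed.

(* The weak limit x along an ultrafilter is turned into the limit of a genuine
   subsequence by choosing u (e k) - x almost orthogonal to its predecessors. *)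
Lemma bounded_weak_subseq (u : nat -> X) (M : R) : (forall n, `|u n| <= M) ->
  exists (e : nat -> nat) (x : X), (forall k, (e k < e k.+1)%N) /\
    forall l : continuous_dual X, sval l (u (e k)) @[k --> \oo] --> sval l x.
Proof.
move=> uM; have [U [UU oU]] := ultraFilterLemma eventually_filter.
have [x xP] := ultra_weak_limit UU uM.
have [|e [ei _ eP]] := @strict_subseq (fun m n => forall j : 'I_m.+1,
    m.+1%:R * `|dot (u j - x) (u n - x)| <= 1).
  move=> m.
  (* Along [U] the vectors [u n - x] tend weakly to 0, so finitely many such conditions hold at once
     for some [n > m]. *)
  have small (j : 'I_m.+1) : \forall n \near U,
      m.+1%:R * `|dot (u j - x) (u n - x)| <= 1.
    have : \forall n \near U, `|dot (u j - x) x - dot (u j - x) (u n)| <= m.+1%:R^-1.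
      by move/cvgrPdist_le : (xP (u j - x)); apply.
    apply: filterS => n; rewrite distrC -dotBr => h.
    by rewrite mulrC -ler_pdivlMr// div1r.
  have [n [mn nP]] : exists n, (m < n)%N /\ forall j : 'I_m.+1,
      m.+1%:R * `|dot (u j - x) (u n - x)| <= 1.
    apply: (@filter_ex _ U); apply: filterI; last exact: filter_forall.
    by apply: oU; exists m.+1.
  by exists n.
exists e, x; split=> // l.
pose z k := u (e k) - x.
have z0 : sval l (z k) @[k --> \oo] --> (0 : R).
  apply: (almost_orthogonal_weak_cvg0 (M := (M + `|x|) ^+ 2)).
    move=> n; rewrite ler_pXn2r ?nnegrE ?addr_ge0// ?(le_trans _ (uM 0%N))//.
    by apply: le_trans (ler_normB _ _) _; rewrite lerD2r.
  (* The weight is 0 at index 0. At [k.+1], [e i <= e k] puts [u (e i)] among the vectors to which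
     [u (e k.+1) - x] was compared. *)
  move=> i [//|k] ik.
  have eik : (e i < (e k).+1)%N.
    rewrite ltnS; move: ik; rewrite ltnS leq_eqVlt.
    by move=> /predU1P[->//|/(strict_homo ei)/ltnW].
  apply: le_trans (eP k (Ordinal eik)).
  by rewrite ler_wpM2r// ler_nat ltnS strict_ge_id.
have -> : (fun k => sval l (u (e k))) = (fun k => sval l (z k) + sval l x).
  by apply/funext => k; rewrite /z linearB/= subrK.
by rewrite -[X in _ --> X]add0r; apply: cvgD z0 (cvg_cst _).
Qed.
End weak_compactness.

(** * The quotient and its maximizers *)

(** The gap is [t * (1 - t) * (A - B) ^+ 2] over a positive denominator. *)
Lemma inv_convex (R : realFieldType) (t A B : R) : 0 <= t <= 1 -> 0 < A -> 0 < B ->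
  (t * A + (1 - t) * B)^-1 <= t / A + (1 - t) / B.
Proof.
move=> /andP[t0 t1] A0 B0.
have D0 : 0 < t * A + (1 - t) * B.
  have [->|t0'] := eqVneq t 0; first by rewrite mul0r subr0 mul1r add0r.
  apply: ltr_wpDr; first by rewrite mulr_ge0 ?subr_ge0// (ltW B0).
  by rewrite mulr_gt0// lt_def t0'.
rewrite -subr_ge0.
have -> : t / A + (1 - t) / B - (t * A + (1 - t) * B)^-1 =
    t * (1 - t) * (A - B) ^+ 2 / (A * B * (t * A + (1 - t) * B)).
  by field; rewrite !gt_eqF.
apply: divr_ge0; last exact: ltW (mulr_gt0 (mulr_gt0 A0 B0) D0).
by apply: mulr_ge0 (sqr_ge0 _); rewrite mulr_ge0// subr_ge0.
Qed.

Lemma near_lt_of_limn_esup (R : realType) (v : nat -> R) (l e : R) :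
  (limn_esup (fun n => (v n)%:E) <= l%:E)%E -> 0 < e ->
  \forall n \near \oo, v n < l + e.
Proof.
move=> vl e0; have : (limn_esup (fun n => (v n)%:E) < (l + e)%:E)%E.
  by apply: le_lt_trans vl _; rewrite lte_fin ltrDl.
move=> /ereal_inf_lt[_ [V oV <-]] Vl; apply: filterS oV => n Vn.
rewrite -lte_fin; apply: le_lt_trans Vl; apply: ereal_sup_ubound.
by exists n.
Qed.

Lemma near_gt_of_limn_einf (R : realType) (v : nat -> R) (l e : R) :
  (l%:E <= limn_einf (fun n => (v n)%:E))%E -> 0 < e ->
  \forall n \near \oo, l - e < v n.
Proof.
rewrite /limn_einf leeNr -EFinN => vl e0.
by apply: filterS (near_lt_of_limn_esup vl e0) => n; lra.
Qed.

(** A failure would give a sequence in [A] tending to [r] and avoiding [P] throughout. Since one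
    good index suffices, continuity needs convergence only along a subsequence. *)
Lemma near_within_seq (R : realType) (A P : set R) (r : R) :
  (forall s : nat -> R, (forall n, A (s n)) -> s @ \oo --> r ->
     exists n, P (s n)) ->
  \forall x \near within A (nbhs r), P x.
Proof.
move=> h; apply: contrapT => nP.
have /choice[s sP] n : exists x, [/\ A x, `|r - x| < n.+1%:R^-1 & ~ P x].
  apply: contrapT => nx; apply: nP; rewrite near_withinE.
  have : \forall x \near r, `|r - x| < n.+1%:R^-1.
    by apply: (@cvgr_dist_lt _ _ _ (nbhs r)); [exact: cvg_id|].
  apply: filterS => x xn Ax; apply: contrapT => nPx; apply: nx.
  by exists x; split.
have sr : s @ \oo --> r.
  apply/cvgrPdist_lt => e e0.
  near=> n; have [_ + _] := sP n; move/lt_trans; apply.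
  near: n; apply: (cvgr_lt 0) => //; exact: cvg_harmonic.
have [n Pn] := h s (fun n => let: And3 a _ _ := sP n in a) sr.
by have [] := sP n.
Unshelve. all: by end_near. Qed.

(** * Elementary estimates from an upper bound [b] of [J] on the ball *)

Section quotient.
Context (R : realType) (X : normedModType R) (J : X -> R) (J0 : J 0 = 0).
Context (rho : R) (rho_gt0 : 0 < rho).
Context (b : R) (J_le : forall y, sqball X rho y -> J y <= b).

Notation eta := (eta_fun J rho).
Notation Gamma := (Gamma_set J rho).

Lemma sqball0 : sqball X rho 0.
Proof. by rewrite /sqball/= normr0 expr0n/= ltW. Qed.

Lemma bound_ge0 : 0 <= b.
Proof. by rewrite -J0; exact: J_le sqball0. Qed.

Lemma quot_le_bound r y : b < r -> sqball X rho y ->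
  (rho - `|y| ^+ 2) / (r - J y) <= rho / (r - b).
Proof.
move=> br By; have Jy := J_le By.
have h1 : 0 < r - J y by rewrite subr_gt0; exact: le_lt_trans br.
rewrite ler_pdivrMr// mulrAC ler_pdivlMr ?subr_gt0//.
apply: ler_pM => //; rewrite ?subr_ge0 ?(ltW br)//; last by rewrite lerD2l lerN2.
by rewrite lerBlDr lerDl.
Qed.

Lemma quot_le_eta r y : b < r -> sqball X rho y ->
  (rho - `|y| ^+ 2) / (r - J y) <= eta r.
Proof.
move=> br By; apply: ub_le_sup; last by exists y.
by exists (rho / (r - b)) => _ [z Bz <-]; exact: quot_le_bound.
Qed.

Lemma eta_le r c :
  (forall y, sqball X rho y -> (rho - `|y| ^+ 2) / (r - J y) <= c) ->
  eta r <= c.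
Proof.
move=> h; apply: ge_sup.
  by exists ((rho - `|0 : X| ^+ 2) / (r - J 0)), 0 => //; exact: sqball0.
by move=> _ [z Bz <-]; exact: h.
Qed.

Lemma eta_le_bound r : b < r -> eta r <= rho / (r - b).
Proof. by move=> br; apply: eta_le => y By; exact: quot_le_bound. Qed.

Lemma eta_ge r : b < r -> rho / r <= eta r.
Proof.
move=> br; have := quot_le_eta br sqball0.
by rewrite normr0 expr0n/= J0 !subr0.
Qed.

Lemma eta_gt0 r : b < r -> 0 < eta r.
Proof.
move=> br; apply: lt_le_trans (eta_ge br).
by rewrite divr_gt0// (le_lt_trans bound_ge0).
Qed.

(** Going from [r] to [s] raises the reciprocal of the quotient by at least [(s - r) / rho]. This
    gain does not depend on [y], so strictness survives the supremum. *)
Lemma eta_decreasing r s : b < r -> r < s -> eta s < eta r.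
Proof.
move=> br rs; have er := eta_gt0 br.
apply: (@le_lt_trans _ _ ((eta r)^-1 + (s - r) / rho)^-1).
  apply: eta_le => y By; have Jy := J_le By.
  have h := quot_le_eta br By; have rJ : 0 < r - J y by lra.
  have sJ : 0 < s - J y by lra.
  have N0 : 0 <= rho - `|y| ^+ 2 by rewrite subr_ge0.
  have Nr : rho - `|y| ^+ 2 <= rho by rewrite lerBlDr lerDl.
  rewrite ler_pdivrMr// in h.
  rewrite ler_pdivrMr// mulrC ler_pdivlMr; last first.
    by rewrite addr_gt0 ?invr_gt0// divr_gt0// subr_gt0.
  rewrite mulrDr.
  have : (rho - `|y| ^+ 2) / eta r <= r - J y by rewrite ler_pdivrMr// mulrC.
  have : (rho - `|y| ^+ 2) * ((s - r) / rho) <= s - r.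
    by rewrite mulrA ler_pdivrMr// mulrC ler_wpM2l// subr_ge0 ltW.
  lra.
rewrite -[ltRHS]invrK ltf_pV2 ?posrE ?invr_gt0//.
  by rewrite ltrDl divr_gt0// subr_gt0.
by rewrite addr_gt0 ?invr_gt0// divr_gt0// subr_gt0.
Qed.

(** For fixed [y] the quotient is a nonnegative multiple of a reciprocal, and suprema preserve
    convexity. *)
Lemma eta_convex r s t : 0 <= t <= 1 -> b < r -> b < s ->
  eta (t * r + (1 - t) * s) <= t * eta r + (1 - t) * eta s.
Proof.
move=> t01 br bs; apply: eta_le => y By; have Jy := J_le By.
have N0 : 0 <= rho - `|y| ^+ 2 by rewrite subr_ge0.
have -> : t * r + (1 - t) * s - J y = t * (r - J y) + (1 - t) * (s - J y) by ring.
have rJ : 0 < r - J y by lra.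
have sJ : 0 < s - J y by lra.
apply: le_trans (ler_wpM2l N0 (inv_convex t01 rJ sJ)) _.
move: (t01) => /andP[t0 t1].
rewrite mulrDr (mulrCA _ t) (mulrCA _ (1 - t)) lerD// ler_wpM2l ?subr_ge0//;
  exact: quot_le_eta.
Qed.

Lemma eta_cvg0 : eta r @[r --> +oo] --> (0 : R).
Proof.
apply/cvgrPdist_le => e e0.
near=> r.
have br : b < r by near: r; apply: nbhs_pinfty_gt; exact: num_real.
rewrite sub0r normrN (gtr0_norm (eta_gt0 br)).
apply: le_trans (eta_le_bound br) _.
rewrite ler_pdivrMr ?subr_gt0// mulrC -ler_pdivrMr// lerBrDr.
by near: r; apply: nbhs_pinfty_ge; exact: num_real.
Unshelve. all: by end_near. Qed.

Lemma penalized_ge r y : b < r -> sqball X rho y ->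
  rho - eta r * r <= `|y| ^+ 2 - eta r * J y.
Proof.
move=> br By; have := quot_le_eta br By; have Jy := J_le By.
by rewrite ler_pdivrMr; lra.
Qed.

Lemma GammaP r x : b < r -> Gamma r x <->
  sqball X rho x /\ `|x| ^+ 2 - eta r * J x = rho - eta r * r.
Proof.
move=> br; split=> -[Bx xE]; split=> //; have Jx := J_le Bx.
  have : rho - `|x| ^+ 2 = eta r * (r - J x).
    by rewrite -xE divfK// gt_eqF//; lra.
  lra.
have -> : rho - `|x| ^+ 2 = eta r * (r - J x) by lra.
by rewrite mulfK// gt_eqF//; lra.
Qed.

(** The quotient at 0 gives [rho <= eta r * r], hence [eta r * J x >= |x|^2]. *)
Lemma Gamma_J_ge0 r x : b < r -> Gamma r x -> 0 <= J x.
Proof.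
move=> br /(GammaP _ br)[Bx xE]; have := eta_ge br.
have r0 : 0 < r by apply: le_lt_trans br; exact: bound_ge0.
rewrite ler_pdivrMr// => h.
have := sqr_ge0 (`|x|) => x0; rewrite -(pmulr_rge0 _ (eta_gt0 br)); lra.
Qed.

Lemma Gamma_norm_lt r x : b < r -> Gamma r x -> `|x| ^+ 2 < rho.
Proof.
move=> br /(GammaP _ br)[Bx xE]; have := J_le Bx.
have e0 := eta_gt0 br => Jb.
have : 0 < eta r * (r - J x) by rewrite mulr_gt0//; lra.
lra.
Qed.

(** If 0 were a maximizer, then [eta r = rho / r] and the penalized minimum would be 0, but [z]
    gives a negative value. *)
Lemma Gamma_neq0 r x z : b < r -> sqball X rho z ->
  r * `|z| ^+ 2 < rho * J z -> Gamma r x -> x != 0.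
Proof.
move=> br Bz rz /(GammaP _ br)[_ xE]; apply/eqP => x0.
have r0 : 0 < r by apply: le_lt_trans br; exact: bound_ge0.
rewrite x0 normr0 expr0n/= J0 in xE.
have := penalized_ge br Bz.
have rE : rho = eta r * r by lra.
have -> : rho - eta r * r = 0 by lra.
rewrite leNgt => /negP; apply; rewrite -(pmulr_rlt0 _ r0); nra.
Qed.

Lemma Gamma_sphere_max r x y : b < r -> Gamma r x -> `|y| = `|x| -> J y <= J x.
Proof.
move=> br xG yx; have /(GammaP _ br)[Bx xE] := xG.
have By : sqball X rho y by rewrite /sqball/= yx.
have := penalized_ge br By; rewrite yx -xE lerD2l lerN2.
by rewrite ler_pM2l// eta_gt0.
Qed.

(* Since Gamma selects J >= 0, the factor s - J y lies in [s - b, s]. *)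
Lemma Gamma_compare r s x y : b < r -> b < s -> Gamma r x -> Gamma s y ->
  `|y| ^+ 2 - eta r * J y <=
    rho - eta r * r + eta r * `|r - s| * (1 + s / (s - b)).
Proof.
move=> br bs xG yG; have y0 := Gamma_J_ge0 bs yG.
have [[Bx xE] [By yE]] := ((GammaP x br).1 xG, (GammaP y bs).1 yG).
have [Jx Jy] := (J_le Bx, J_le By).
have er := eta_gt0 br.
have Q0 : 0 < s - J x by lra.
have P0 : 0 < s - J y by lra.
have xs := penalized_ge bs Bx.
(* Testing the inequality for [s] at [x] gives [eta s >= eta r * (r - J x) / (s - J x)]; then
   [r - J x] is split as [(s - J x) - (s - r)]. *)
have h : eta r * (s - J y - (s - r) * ((s - J y) / (s - J x))) <= eta s * (s - J y).
  have -> : eta r * (s - J y - (s - r) * ((s - J y) / (s - J x))) =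
    eta r * (r - J x) * (s - J y) / (s - J x) by field; rewrite gt_eqF.
  rewrite ler_pdivrMr// -mulrA [leRHS]mulrAC mulrA ler_wpM2r ?(ltW P0)//; lra.
have PQ : (s - J y) / (s - J x) <= s / (s - b).
  by apply: ler_pM; rewrite ?invr_ge0 ?(ltW P0) ?(ltW Q0)// ?lef_pV2 ?posrE//; lra.
have PQ0 : 0 <= (s - J y) / (s - J x) by rewrite divr_ge0// ltW.
have : eta r * ((s - r) * ((s - J y) / (s - J x) - 1)) <=
    eta r * (`|r - s| * (1 + s / (s - b))).
  rewrite ler_wpM2l ?(ltW er)// (le_trans (ler_norm _))// normrM distrC.
  rewrite ler_wpM2l// (le_trans (ler_normB _ _))// normr1 addrC lerD2l.
  by rewrite ger0_norm.
lra.
Qed.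

End quotient.

(** * Weak limits of minimizing sequences and the first-order condition *)

Section weak_minimization.
Context (R : realType) (X : completeNormedModType R).
Context (dot : {dot X for @idfun R}) (hdot : induces_norm dot).

Lemma weak_cvg_dot (u : nat -> X) (x v : X) :
  u @ \oo --> (x : weak_space X) -> dot v (u n) @[n --> \oo] --> dot v x.
Proof. by move=> /weak_cvgP/(_ (dot_dual hdot v)). Qed.

(** From |u n - x|^2 >= 0, |u n|^2 is at least [2 * dot x (u n)] - |x|^2, which tends to |x|^2. *)
Lemma sqnorm_weak_lsc (u : nat -> X) (x : X) (e : R) :
  u @ \oo --> (x : weak_space X) -> 0 < e ->
  \forall n \near \oo, `|x| ^+ 2 - e < `|u n| ^+ 2.
Proof.
move=> /(weak_cvg_dot (v := x)) ux e0; near=> n.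
have : 0 <= `|u n - x| ^+ 2 by rewrite sqr_ge0.
rewrite (sqnormB hdot) (dotC dot).
have : `|x| ^+ 2 - e / 2 < dot x (u n).
  near: n; apply: (cvgr_gt (dot x x)) => //.
  by rewrite -hdot ltrBlDr ltrDl divr_gt0.
by lra.
Unshelve. all: by end_near. Qed.

Lemma sqball_weak_closed (u : nat -> X) (x : X) (rho : R) :
  u @ \oo --> (x : weak_space X) -> (forall n, sqball X rho (u n)) ->
  sqball X rho x.
Proof.
move=> ux uB; apply/ler_addgt0Pr => e e0.
have [n xn] := filter_ex (sqnorm_weak_lsc ux e0).
have := uB n; rewrite /sqball/=; lra.
Qed.

Section penalized.
Context (J : X -> R) (rho a : R) (a_gt0 : 0 < a).
Context (lsc : seq_lower_semicontinuous_in (T := weak_space X) (sqball X rho)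
  (fun x : X => `|x| ^+ 2 - a * J x)).

(** The error [w] lets this serve both existence at a fixed parameter and stability when the
    parameter varies. *)
Lemma minimizing_weak_subseq (mu c : R) (u : nat -> X) (w : nat -> R) :
  0 <= mu <= a -> (forall n, sqball X rho (u n)) ->
  (forall n, `|u n| ^+ 2 - mu * J (u n) <= c + w n) ->
  w @ \oo --> (0 : R) ->
  exists (e : nat -> nat) (x : X), [/\ (forall k, (e k < e k.+1)%N),
    u (e k) @[k --> \oo] --> (x : weak_space X), sqball X rho x &
    `|x| ^+ 2 - mu * J x <= c].
Proof.
move=> /andP[mu0 mua] uB uc w0.
have [|e [x [ei ux]]] := @bounded_weak_subseq _ _ _ hdot u (rho + 1).
  by move=> n; have := uB n; rewrite /sqball/=; have := sqr_ge0 (`|u n| - 1); nra.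
have {}ux : u (e k) @[k --> \oo] --> (x : weak_space X) by exact/weak_cvgP.
have Bx := sqball_weak_closed ux (fun k => uB (e k)).
exists e, x; split => //; apply/ler_addgt0Pr => d d0.
have d3 : 0 < d / 2 by rewrite divr_gt0.
have l1 := near_gt_of_limn_einf (lsc (fun k => uB (e k)) Bx ux) d3.
have l2 := sqnorm_weak_lsc ux d3.
have l3 : \forall k \near \oo, w (e k) < d / 2.
  by apply: (cvgr_lt 0) => //; exact: cvg_comp (cvg_strict ei) w0.
have [k [[h1 h2] h3]] := filter_ex (filterI (filterI l1 l2) l3).
(* |.|^2 - mu J is a convex combination of |.|^2 and |.|^2 - a J. *)
have p0 : 0 <= mu / a by rewrite divr_ge0// ltW.
have p1 : mu / a <= 1 by rewrite ler_pdivrMr// mul1r.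
have E (N j : R) : N - mu * j = (1 - mu / a) * N + (mu / a) * (N - a * j).
  by field; rewrite gt_eqF.
have := uc (e k); rewrite (E _ (J x)) (E _ (J (u _))).
have := ler_wpM2l p0 (ltW h1).
have q0 : 0 <= 1 - mu / a by rewrite subr_ge0.
have := ler_wpM2l q0 (ltW h2); lra.
Qed.

End penalized.

(** Minimality at [x] against [h *: v + x], divided by [h > 0], gives one inequality in the limit;
    replacing [v] by [- v] gives the other. *)
Lemma interior_min_gateaux (J : X -> R) (rho mu : R) (x : X)
    (l : continuous_dual X) :
  0 < mu -> `|x| ^+ 2 < rho ->
  (forall y, sqball X rho y -> `|x| ^+ 2 - mu * J x <= `|y| ^+ 2 - mu * J y) ->
  is_gateaux_derivative J x l -> forall v, mu * sval l v = 2 * dot x v.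
Proof.
move=> mu0 xrho xmin Jl.
have half v : mu * sval l v <= 2 * dot x v.
  have [Jd <-] := Jl v.
  have h1 : mu * (h^-1 *: ((J \o shift x) (h *: v) - J x)) @[h --> 0^'+] -->
      mu * 'D_v J x.
    apply: cvgMr; exact: cvg_dnbhs_at_right Jd.
  have h2 : 2 * dot x v + h * `|v| ^+ 2 @[h --> (0:R)^'+] -->
      2 * dot x v + 0 * `|v| ^+ 2.
    apply: cvgD; first exact: cvg_cst.
    by apply: cvgMl; exact: cvg_at_right_filter.
  rewrite mul0r addr0 in h2; apply: ler_cvg_to h1 h2 _.
  (* This limit is below [rho], so the comparison points stay in the ball for small [h]. *)
  have h3 : `|x| ^+ 2 + 2 * h * dot x v + h ^+ 2 * `|v| ^+ 2 @[h --> (0:R)^'+] -->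
     `|x| ^+ 2 + 2 * 0 * dot x v + 0 ^+ 2 * `|v| ^+ 2.
    apply: cvg_at_right_filter; apply: cvgD.
      by apply: cvgD; [exact: cvg_cst|apply: cvgMl; apply: cvgMr].
    by apply: cvgMl; exact: exprn_continuous.
  near=> h.
  have hp : 0 < h by near: h; exact: nbhs_right_gt.
  have E : `|h *: v + x| ^+ 2 = `|x| ^+ 2 + 2 * h * dot x v + h ^+ 2 * `|v| ^+ 2.
    by rewrite addrC (sqnormD hdot) (sqnormZ hdot) dotZr; ring.
  have := xmin (h *: v + x); rewrite /sqball/= E.
  have -> : `|x| ^+ 2 + 2 * h * dot x v + h ^+ 2 * `|v| ^+ 2 <= rho.
    apply: ltW; near: h; apply: (cvgr_lt _ h3).
    by rewrite mulr0 expr0n/= !mul0r !addr0.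
  move=> /(_ isT) Jh.
  rewrite mulrCA ler_pdivrMl//; lra.
move=> v; apply/le_anti/andP; split=> //.
by have := half (- v); rewrite !linearN/=; lra.
Unshelve. all: by end_near. Qed.

End weak_minimization.

(** * Existence, stability and gradient equation of the maximizers *)

Section maximizers.
Context (R : realType) (X : completeNormedModType R).
Context (dot : {dot X for @idfun R}) (hdot : induces_norm dot).
Context (J : X -> R) (J0 : J 0 = 0) (rho : R) (rho_gt0 : 0 < rho).
Context (b : R) (J_le : forall y, sqball X rho y -> J y <= b).
Context (a : R) (a_gt0 : 0 < a).
Context (lsc : seq_lower_semicontinuous_in (T := weak_space X) (sqball X rho)
  (fun x : X => `|x| ^+ 2 - a * J x)).

Notation eta := (eta_fun J rho).
Notation Gamma := (Gamma_set J rho).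

(** The condition on [r] makes the bound [rho / (r - b)] at most [a]. *)
Lemma eta_le_threshold r : b + rho / a < r -> b < r /\ 0 <= eta r <= a.
Proof.
move=> ar; have br : b < r.
  by apply: le_lt_trans ar; rewrite lerDl divr_ge0// ltW.
split=> //; rewrite (ltW (eta_gt0 J0 rho_gt0 J_le br))/=.
apply: le_trans (eta_le_bound rho_gt0 J_le br) _.
rewrite ler_pdivrMr ?subr_gt0// mulrC -ler_pdivrMr//; lra.
Qed.

Lemma Gamma_nonempty r : b + rho / a < r -> Gamma r !=set0.
Proof.
move=> ar; have [br mua] := eta_le_threshold ar.
have mu0 := eta_gt0 J0 rho_gt0 J_le br.
pose Q := [set (rho - `|y| ^+ 2) / (r - J y) | y in sqball X rho].
have hQ : has_sup Q.
  split; first by exists ((rho - `|0 : X| ^+ 2) / (r - J 0)), 0 => //; exact: sqball0.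
  by exists (eta r) => _ [z Bz <-]; exact: (quot_le_eta J_le br Bz).
have /choice[u uP] n : exists y, sqball X rho y /\
    `|y| ^+ 2 - eta r * J y <= rho - eta r * r + rho * n.+1%:R^-1.
  have n0 : 0 < n.+1%:R^-1 :> R by [].
  have n1 : n.+1%:R^-1 <= 1 :> R by rewrite invf_le1// ler1n.
  (* This tolerance keeps the quotient above [eta r / 2], so [eta r / 2 * (r - J y) <= rho] without
     any lower bound on [J]. *)
  have d0 : 0 < eta r / 2 * n.+1%:R^-1 by rewrite mulr_gt0// divr_gt0.
  have [_ [y By <-]] := sup_adherent d0 hQ.
  rewrite -/(eta r) => yQ; exists y; split=> //.
  have Jy := J_le By; have rJ : 0 < r - J y by lra.
  rewrite ltr_pdivlMr// in yQ.
  have y2 := sqr_ge0 `|y|.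
  move: (n.+1%:R^-1) n0 n1 yQ => d d0' d1 yQ.
  have h1 : eta r / 2 * (r - J y) <= rho.
    have : eta r / 2 * d * (r - J y) <= eta r / 2 * (r - J y).
      by rewrite ler_pM2r// ler_piMr// divr_ge0// ltW.
    lra.
  have := ler_wpM2r (ltW d0') h1; lra.
have [|e [x [_ _ Bx xmin]]] := @minimizing_weak_subseq _ _ _ hdot _ _ _ a_gt0 lsc
  (eta r) (rho - eta r * r) u (fun n => rho * n.+1%:R^-1) mua
  (fun n => (uP n).1) (fun n => (uP n).2).
  by rewrite -[X in _ --> X](mulr0 rho); apply: cvgMr; exact: cvg_harmonic.
exists x; apply/(GammaP J_le _ br); split=> //.
apply/le_anti; rewrite xmin /=; exact: (penalized_ge J_le).
Qed.

(** By [Gamma_compare] the [y n] are minimizing at [r], so a weak subsequential limit lies in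
    [Gamma r] and equals [x]. Upper semicontinuity then bounds the limit superior of the norms by
    that of [x], which makes the convergence strong. *)
Lemma Gamma_seq_cvg (r : R) (s : nat -> R) (x : X) (y : nat -> X) :
  b + rho / a < r -> (forall n, b < s n) -> s @ \oo --> r ->
  Gamma r = [set x] -> (forall n, Gamma (s n) (y n)) ->
  exists e : nat -> nat, [/\ (forall k, (e k < e k.+1)%N),
    y (e k) @[k --> \oo] --> (x : weak_space X) &
    seq_upper_semicontinuous_in (T := weak_space X) (sqball X rho) J ->
      y (e k) @[k --> \oo] --> x].
Proof.
move=> ar bs sr Gr yG; have [br mua] := eta_le_threshold ar.
have mu0 := eta_gt0 J0 rho_gt0 J_le br.
have xG : Gamma r x by rewrite Gr.
have [Bx xE] := (GammaP J_le x br).1 xG.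
have yB n : sqball X rho (y n) by case: (yG n).
pose w n := eta r * `|r - s n| * (1 + s n / (s n - b)).
have yw n : `|y n| ^+ 2 - eta r * J (y n) <= rho - eta r * r + w n.
  exact: (Gamma_compare J0 rho_gt0 J_le br (bs n) xG (yG n)).
have w0 : w @ \oo --> (0 : R).
  have -> : 0 = eta r * `|r - r| * (1 + r / (r - b)) :> R.
    by rewrite subrr normr0 mulr0 mul0r.
  apply: cvgM.
    by apply: cvgMr; apply: cvg_norm; apply: cvgB => //; exact: cvg_cst.
  apply: cvgD; first exact: cvg_cst.
  apply: cvgM => //; apply: cvgV; first by rewrite gt_eqF// subr_gt0.
  by apply: cvgB => //; exact: cvg_cst.
have [e [x' [ei yx' Bx' x'min]]] := minimizing_weak_subseq hdot a_gt0 lsc mua yB yw w0.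
have x'x : x' = x.
  suff : Gamma r x' by rewrite Gr.
  apply/(GammaP J_le _ br); split=> //.
  by apply/le_anti; rewrite x'min; exact: (penalized_ge J_le).
rewrite x'x in yx'.
exists e; split=> // usc; apply/cvgrPdist_lt => d d0.
(* Four errors of size [c]: two from the doubled inner product, one from [J], one from [w]. *)
pose c := d ^+ 2 / 4.
have c0 : 0 < c by rewrite divr_gt0// exprn_gt0.
near=> k.
have h1 : J (y (e k)) < J x + c / eta r.
  near: k; apply: near_lt_of_limn_esup; last exact: divr_gt0.
  exact: usc (fun k => yB (e k)) Bx yx'.
have h2 : w (e k) < c.
  by near: k; apply: (cvgr_lt 0) => //; exact: cvg_comp (cvg_strict ei) w0.
have h3 : `|x| ^+ 2 - c < dot x (y (e k)).
  near: k; apply: (cvgr_gt (dot x x)); first exact: weak_cvg_dot.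
  by rewrite hdot ltrBlDr ltrDl.
have h4 := yw (e k).
have h5 : eta r * (J (y (e k)) - J x) < c.
  by rewrite mulrC -ltr_pdivlMr// ltrBlDl.
rewrite -(@ltr_pXn2r _ 2)// ?nnegrE ?(ltW d0)// (sqnormB hdot).
have -> : d ^+ 2 = 4 * c by rewrite /c; field.
lra.
Unshelve. all: by end_near. Qed.

Section gateaux.
Context (J_diff : forall x : X, (sqball_int X rho `\ 0) x ->
  gateaux_differentiable J x).
Context (r : R) (br : b < r) (z : X) (Bz : sqball X rho z).
Context (rz : r * `|z| ^+ 2 < rho * J z).

(** The point [z] forces maximizers away from 0; being interior as well, they are points of
    differentiability. *)
Lemma Gamma_gateaux x : Gamma r x -> exists2 l : continuous_dual X,
  is_gateaux_derivative J x l & forall v, eta r * sval l v = 2 * dot x v.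
Proof.
move=> xG; have xr := Gamma_norm_lt J0 rho_gt0 J_le br xG.
have x0 := Gamma_neq0 J0 rho_gt0 J_le br Bz rz xG.
have [|l lx] := J_diff (x := x); first by split=> // /eqP; apply/negP.
exists l => //; have [_ xE] := (GammaP J_le x br).1 xG.
apply: (interior_min_gateaux hdot (eta_gt0 J0 rho_gt0 J_le br) xr _ lx) => y By.
by rewrite xE; exact: (penalized_ge J_le).
Qed.

Lemma Gamma_gradient x : Gamma r x ->
  exists2 g, is_gateaux_gradient dot J x g & x = (eta r / 2) *: g.
Proof.
move=> xG; have [l lx lE] := Gamma_gateaux xG.
have mu0 := eta_gt0 J0 rho_gt0 J_le br.
exists ((2 / eta r) *: x).
  exists l => // v; rewrite dotZl mulrAC -lE; field; exact: lt0r_neq0.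
rewrite scalerA (_ : _ * _ = 1) ?scale1r//; field; exact: lt0r_neq0.
Qed.

(** Adding the two minimality inequalities gives [J y <= J x], and the one for [s] then gives the
    weak inequality of norms. *)
Lemma Gamma_norm_decreasing s x y : r < s -> Gamma r x -> Gamma s y ->
  `|y| < `|x|.
Proof.
move=> rs xG yG; have bs := lt_trans br rs.
have e21 := eta_decreasing J0 rho_gt0 J_le br rs.
have e2 := eta_gt0 J0 rho_gt0 J_le bs.
have [[Bx xE] [By yE]] := ((GammaP J_le x br).1 xG, (GammaP J_le y bs).1 yG).
have xy := penalized_ge J_le br By.
have yx := penalized_ge J_le bs Bx.
have Jyx : J y <= J x.
  rewrite -subr_ge0 -(pmulr_rge0 _ (_ : 0 < eta r - eta s)) ?subr_gt0//; lra.
have nyx : `|y| ^+ 2 <= `|x| ^+ 2.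
  have : eta s * (J x - J y) >= 0 by rewrite mulr_ge0 ?subr_ge0// ltW.
  lra.
rewrite lt_def -(@ler_pXn2r _ 2)// ?nnegrE// nyx andbT.
apply/eqP => nE.
(* Equal norms would put x in both Gamma r and Gamma s, and then the gradient
   of J at x would be both (2 / eta r) x and (2 / eta s) x. *)
have JE : J x = J y.
  apply/le_anti; rewrite Jyx andbT -subr_ge0 -(pmulr_rge0 _ e2).
  by rewrite nE in yx; lra.
have xmin : forall v, sqball X rho v ->
    `|x| ^+ 2 - eta s * J x <= `|v| ^+ 2 - eta s * J v.
  by move=> v Bv; rewrite nE JE yE; exact: (penalized_ge J_le).
have [l lx lE] := Gamma_gateaux xG.
have lE' := interior_min_gateaux hdot e2
  (Gamma_norm_lt J0 rho_gt0 J_le br xG) xmin lx x.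
have : (eta r - eta s) * sval l x = 0 by rewrite mulrBl lE lE' subrr.
move/eqP; rewrite mulf_eq0 gt_eqF ?subr_gt0//= => /eqP lx0.
have := lE x; rewrite lx0 mulr0 -hdot => /esym/eqP.
rewrite mulf_eq0 pnatr_eq0/= sqrf_eq0 normr_eq0.
by apply/negP; exact: (Gamma_neq0 J0 rho_gt0 J_le br Bz rz xG).
Qed.

End gateaux.
End maximizers.

(** * From extended-real hypotheses to the four assertions *)

(** The value [+oo] would make the left side of the strict inequality infinite, and [J 0 = 0]
    excludes [-oo]. *)
Lemma beta_sup_fin (R : realType) (X : normedModType R) (J : X -> R) (rho : R) :
  J 0 = 0 -> 0 < rho -> (beta_sup J rho / rho%:E < delta_sup J rho)%E ->
  exists2 b : R, beta_sup J rho = b%:E &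
    forall y, sqball X rho y -> J y <= b.
Proof.
move=> J0 rho_gt0 bd.
have ub y : sqball X rho y -> ((J y)%:E <= beta_sup J rho)%E.
  by move=> By; apply: ereal_sup_ubound; exists y.
case E : (beta_sup J rho) bd ub => [b||] bd ub.
- by exists b => // y /ub; rewrite lee_fin.
- by move: bd; rewrite inver gt_eqF// gt0_mulye ?lte_fin ?invr_gt0// ltNge leey.
- by have := ub 0 (sqball0 X rho_gt0); rewrite leeNy_eq.
Qed.

(** Supplies the point [z] used to show that maximizers are nonzero; the case [delta_sup = +oo] is
    included. *)
Lemma delta_sup_gt (R : realType) (X : normedModType R) (J : X -> R) (rho r : R) :
  0 < rho -> (r%:E < rho%:E * delta_sup J rho)%E ->
  exists2 z, sqball X rho z & r * `|z| ^+ 2 < rho * J z.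
Proof.
move=> rho_gt0; rewrite muleC -lte_pdivrMr// => /ereal_sup_gt[_ [z [Bz z0] <-]].
rewrite -EFinM lte_fin => rz; exists z => //.
have z2 : 0 < `|z| ^+ 2 by rewrite exprn_gt0// normr_gt0; apply/eqP.
by move: rz; rewrite ltr_pdivrMr// mulrAC ltr_pdivlMr// (mulrC rho).
Qed.

Theorem theorem1 (R : realType) (X : completeNormedModType R)
  (dot : {dot X for @idfun R}) (hdot : induces_norm dot)
  (J : X -> R) (J0 : J 0 = 0)
  (rho : R) (rho_gt0 : 0 < rho)
  (J_diff : forall x : X, (sqball_int X rho `\ 0) x ->
     gateaux_differentiable J x)
  (beta_delta : (beta_sup J rho / rho%:E < delta_sup J rho)%E)
  (a : R) (a_gt0 : 0 < a)
  (a_gt : (delta_sup J rho < +oo)%E ->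
     (rho%:E / (rho%:E * delta_sup J rho - beta_sup J rho) < a%:E)%E)
  (lsc : seq_lower_semicontinuous_in (T := weak_space X) (sqball X rho)
     (fun x : X => `|x| ^+ 2 - a * J x)) :
  let D := [set r : R | (beta_sup J rho < r%:E)%E] in
  let I := [set r : R | (beta_sup J rho + (rho / a)%:E < r%:E)%E /\
                        (r%:E < rho%:E * delta_sup J rho)%E] in
  let eta := eta_fun J rho in
  let Gamma := Gamma_set J rho in
  let A := [set r : R | I r /\ exists x : X, Gamma r = [set x]] in
  [/\ [/\ convex_function (D : set R^o) eta,
          forall r s : R, D r -> D s -> r < s -> eta s < eta r &
          eta r @[r --> +oo] --> (0 : R)],
      forall r : R, I r ->
        Gamma r !=set0 /\
        forall xh : X, Gamma r xh ->
          let S1 := [set x : X | sqsphere X (`|xh| ^+ 2) x /\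
            (J x)%:E = sup_on (sqsphere X (`|xh| ^+ 2)) J] in
          let S2 := [set x : X | sqball_int X rho x /\
            (`|x| ^+ 2 - eta r * J x)%:E =
              inf_on (sqball X rho) (fun y => `|y| ^+ 2 - eta r * J y)] in
          let S3 := [set x : X | exists2 g : X, is_gateaux_gradient dot J x g &
            x = (eta r / 2) *: g] in
          [/\ 0 < `|xh| ^+ 2 < rho, S1 xh, S1 `<=` S2 & S2 `<=` S3],
      forall (r1 r2 : R) (xh yh : X), I r1 -> I r2 -> r1 < r2 ->
        Gamma r1 xh -> Gamma r2 yh -> `|yh| < `|xh| &
      {within A, continuous (fun r : R => get (Gamma r) : weak_space X)} /\
      (seq_upper_semicontinuous_in (T := weak_space X) (sqball X rho) J ->
       {within A, continuous (fun r : R => get (Gamma r) : X)})].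
Proof.
have [b bE J_le] := beta_sup_fin J0 rho_gt0 beta_delta.
rewrite bE => D I eta Gamma A.
have DE r : D r -> b < r by rewrite /D/= lte_fin.
have IE r : I r -> b + rho / a < r by rewrite /I/= -EFinD lte_fin => -[].
have Iz r : I r -> exists2 z, sqball X rho z & r * `|z| ^+ 2 < rho * J z.
  by move=> [_ rd]; exact: delta_sup_gt rd.
have Ib r : I r -> b < r.
  by move=> /IE ar; have [] := eta_le_threshold J0 rho_gt0 J_le a_gt0 ar.
have seq_cvg (r : R) (s : nat -> R) : A r -> (forall n, A (s n)) -> s @ \oo --> r ->
    exists e : nat -> nat, [/\ (forall k, (e k < e k.+1)%N),
      get (Gamma (s (e k))) @[k --> \oo] --> (get (Gamma r) : weak_space X) &
      seq_upper_semicontinuous_in (T := weak_space X) (sqball X rho) J ->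
        get (Gamma (s (e k))) @[k --> \oo] --> get (Gamma r)].
  move=> [Ir [x Gx]] As sr.
  have getG t : A t -> Gamma t (get (Gamma t)).
    by move=> [_ [y Gy]]; apply: getPex; exists y; rewrite Gy.
  have -> : get (Gamma r) = x.
    by have := getG r (conj Ir (ex_intro _ x Gx)); rewrite {1}Gx.
  exact: (Gamma_seq_cvg hdot J0 rho_gt0 J_le a_gt0 lsc (IE r Ir)
    (fun n => Ib _ (As n).1) sr Gx (fun n => getG _ (As n))).
split.
- split.
  + move=> t r s; rewrite !inE => /DE br /DE bs.
    have t01 : 0 <= t%:num <= 1 by rewrite ge0 le1.
    exact: (eta_convex rho_gt0 J_le t01 br bs).
  + by move=> r s /DE br _; exact: eta_decreasing J_le _ _ br.
  + exact: eta_cvg0 J_le.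
- move=> r Ir; have [ar br] := (IE r Ir, Ib r Ir); have [z Bz rz] := Iz r Ir.
  split; first exact: (Gamma_nonempty hdot J0 rho_gt0 J_le a_gt0 lsc ar).
  move=> xh xG S1 S2 S3.
  have [Bxh xhE] := (GammaP J_le xh br).1 xG.
  have xhmax : (J xh)%:E = sup_on (sqsphere X (`|xh| ^+ 2)) J.
    apply/le_anti/andP; split; first by apply: ereal_sup_ubound; exists xh.
    apply: ge_ereal_sup => _ [y yxh <-]; rewrite lee_fin.
    apply: (Gamma_sphere_max J0 rho_gt0 J_le br xG).
    by apply/eqP; rewrite -(@eqrXn2 _ 2)//; apply/eqP.
  have xhlt := Gamma_norm_lt J0 rho_gt0 J_le br xG.
  have infE : inf_on (sqball X rho) (fun y => `|y| ^+ 2 - eta r * J y) =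
      (rho - eta r * r)%:E.
    apply/le_anti/andP; split.
      by apply: ereal_inf_lbound; exists xh => //; rewrite xhE.
    apply: le_ereal_inf_tmp => _ [y By <-]; rewrite lee_fin.
    exact: (penalized_ge J_le).
  split=> //.
  + rewrite xhlt andbT exprn_gt0// normr_gt0.
    exact: (Gamma_neq0 J0 rho_gt0 J_le br Bz rz xG).
  (* A maximizer on the sphere shares with [xh] both the norm and the value of [J], hence the
     penalized value. *)
  + move=> x [xxh]; rewrite -xhmax => -[Jx]; split; first by rewrite /sqball_int/= xxh.
    by rewrite infE xxh Jx xhE.
  (* A minimizer of the penalized functional is itself in [Gamma r]. *)
  + move=> x [xlt]; rewrite infE => -[xE].
    apply: (Gamma_gradient hdot J0 rho_gt0 J_le J_diff br Bz rz).
    by apply/(GammaP J_le x br); split=> //; exact: ltW.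
- move=> r s x y Ir Is rs xG yG; have [z Bz rz] := Iz r Ir.
  exact: (Gamma_norm_decreasing hdot J0 rho_gt0 J_le J_diff (Ib r Ir) Bz rz rs xG yG).
- split=> [|usc]; apply/subspace_continuousP => r Ar.
    apply/weak_cvgP => l; apply/cvgrPdist_lt => e e0.
    apply: near_within_seq => s As sr.
    have [d [_ /weak_cvgP/(_ l)/cvgrPdist_lt/(_ e e0) ds _]] := seq_cvg r s Ar As sr.
    by have [k] := filter_ex ds; exists (d k).
  apply/cvgrPdist_lt => e e0.
  apply: near_within_seq => s As sr.
  have [d [_ _ /(_ usc)/cvgrPdist_lt/(_ e e0) ds]] := seq_cvg r s Ar As sr.
  by have [k] := filter_ex ds; exists (d k).
Qed.
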